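(* Let $A\neq 0$ be a square matrix with Kronecker sum structure, let $b$ be a vector of compatible size, and let $p\ge 0$ be an integer. Let $$I_{p+1}=\varphi_{p+1}(A)b=\int_0^1\frac{\theta^{p}}{p!}e^{(1-\theta)A}b\,d\theta ,\qquad \hat I_{p+1}=\sum_{i=1}^{n+1}w_i\frac{x_i^{p}}{p!}e^{(1-x_i)A}b,$$ where $\{(w_i,x_i)\}_{i=1}^{n+1}$ are the weights and nodes on $[0,1]$ of either the $(n+1)$-point Clenshaw–Curtis rule or the $(n+1)$-point Gauss–Legendre rule. Assume $n\ge 4$ in the Clenshaw–Curtis case and $n\ge 2$ in the Gaussian case. Define, for $\rho>1$, $$g(\rho)=\frac{(\rho+1)^2}{2\rho},\qquad M(\rho)=\frac{g(\rho)^p}{2^{p+1}p!}\,e^{\frac12 g(\rho)\lVert A\rVert_\infty}\,\lVert b\rVert_\infty .$$ Consider the monic polynomial equation $$\rho^4+a_3\rho^3+a_2\rho^2+a_1\rho+1=0 \qquad (\ast)$$ with coefficients - Clenshaw–Curtis: $a_3=-4\lVert A\rVert_\infty^{-1}(n+1-p)$, $a_2=-(2+8p\lVert A\rVert_\infty^{-1})$, $a_1=4\lVert A\rVert_\infty^{-1}(n-1+p)$; - Gaussian quadrature: $a_3=-4\lVert A\rVert_\infty^{-1}(2(n+1)-p)$, $a_2=-(2+8p\lVert A\rVert_\infty^{-1})$, $a_1=4\lVert A\rVert_\infty^{-1}(2n+p)$. Then, in each case, there is a real root $\bar\rho>1$ of the corresponding equation $(\ast)$ such that $$\lVert I_{p+1}-\hat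 I_{p+1}\rVert_\infty\le\frac{144}{35}\,\frac{M(\bar\rho)\,\bar\rho^{\,1-n}}{\bar\rho^{2}-1}\quad\text{for Clenshaw–Curtis quadrature},$$ $$\lVert I_{p+1}-\hat I_{p+1}\rVert_\infty\le\frac{144}{35}\,\frac{M(\bar\rho)\,\bar\rho^{\,-2n}}{\bar\rho^{2}-1}\quad\text{for Gaussian quadrature}.$$ Moreover, if $n$ is even, then in the Clenshaw–Curtis case $n$ can be replaced by $n+1$ both in the bound and in the coefficients of $(\ast)$ (the number of quadrature nodes used for $\hat I_{p+1}$ remaining $n+1$): there is a real root $\bar\rho>1$ of $(\ast)$ with $a_3=-4\lVert A\rVert_\infty^{-1}(n+2-p)$, $a_2=-(2+8p\lVert A\rVert_\infty^{-1})$, $a_1=4\lVert A\rVert_\infty^{-1}(n+p)$ such that $\lVert I_{p+1}-\hat I_{p+1}\rVert_\infty\le\frac{144}{35}\frac{M(\bar\rho)\bar\rho^{-n}}{\bar\rho^2-1}$.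
   Context: For a square matrix $A$ and an integer $q\ge1$, $\varphi_q(A)=\int_0^1 e^{(1-\theta)A}\frac{\theta^{q-1}}{(q-1)!}\,d\theta$. The convention $\theta^0=1$ is used. $\lVert\cdot\rVert_\infty$ is the maximum norm for vectors and the induced operator norm (maximum absolute row sum) for matrices. Kronecker sum structure means $A=A^x\otimes I^y+I^x\otimes A^y$ (2D) or $A=A^x\otimes I^y\otimes I^z+I^x\otimes A^y\otimes I^z+I^x\otimes I^y\otimes A^z$ (3D), where $A^x,A^y,A^z$ are square matrices, $I^x,I^y,I^z$ are identity matrices of the matching sizes, and $\otimes$ is the Kronecker product. The $(n+1)$-point Gauss–Legendre rule on $[-1,1]$ is the interpolatory rule whose nodes are the zeros of the Legendre polynomial of degree $n+1$. The $(n+1)$-point Clenshaw–Curtis rule on $[-1,1]$ is the interpolatory rule with nodes $\cos(k\pi/n)$, $k=0,\dots,n$. The rules on $[0,1]$ are obtained by the affine map $\theta=(s+1)/2$, $s\in[-1,1]$, with the weights halved. All computations are in exact arithmetic. *)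

(* Defs.v *)
From HB Require Import structures.
From mathcomp Require Import all_boot all_order all_algebra.
From mathcomp Require Import complex mxtens.
From mathcomp Require Import all_classical all_reals all_analysis.
Import Order.TTheory GRing.Theory Num.Theory.
Import numFieldNormedType.Exports.

Set Implicit Arguments.
Unset Strict Implicit.
Unset Printing Implicit Defensive.

Local Open Scope ring_scope.
Local Open Scope complex_scope.
Local Open Scope classical_set_scope.

(* Scalars are complex numbers [R[i]] over an arbitrary [R : realType], so that
   real matrices and vectors are included (as those with zero imaginary part).
   [*t] is the Kronecker product of real-closed's mxtens. *)

Inductive kronecker_sum (K : pzRingType) : forall N, 'M[K]_N -> Prop :=
| Kronecker_sum2 (nx ny : nat) (Ax : 'M[K]_nx) (Ay : 'M[K]_ny) :
    kronecker_sum (Ax *t (1%:M : 'M[K]_ny) + (1%:M : 'M[K]_nx) *t Ay)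
| Kronecker_sum3 (nx ny nz : nat)
    (Ax : 'M[K]_nx) (Ay : 'M[K]_ny) (Az : 'M[K]_nz) :
    kronecker_sum
      (Ax *t (1%:M : 'M[K]_ny) *t (1%:M : 'M[K]_nz)
       + (1%:M : 'M[K]_nx) *t Ay *t (1%:M : 'M[K]_nz)
       + (1%:M : 'M[K]_nx) *t (1%:M : 'M[K]_ny) *t Az).

Section MatrixFunctions.
Variable R : realType.

Definition vnorm_infty N (v : 'cV[R[i]]_N) : R :=
  \big[Num.max/0]_(i < N) ComplexField.Normc.normc (v i 0).

Definition mnorm_infty N (A : 'M[R[i]]_N) : R :=
  \big[Num.max/0]_(i < N) \sum_(j < N) ComplexField.Normc.normc (A i j).

Definition limC (u : nat -> R[i]) : R[i] :=
  limn (fun k => complex.Re (u k)) +i* limn (fun k => complex.Im (u k)).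

Definition int01C (f : R -> R[i]) : R[i] :=
  (\int[lebesgue_measure]_(t in `[0, 1]) complex.Re (f t))
  +i* (\int[lebesgue_measure]_(t in `[0, 1]) complex.Im (f t)).

Definition expmx N (A : 'M[R[i]]_N) : 'M[R[i]]_N :=
  \matrix_(i, j)
    limC (fun m => (\sum_(k < m) ((k`!)%:R^-1 : R[i]) *: A ^+ k) i j).

(* Only meaningful for [0 < q]. *)
Definition phi (q : nat) N (A : 'M[R[i]]_N) : 'M[R[i]]_N :=
  \matrix_(i, j)
    int01C (fun t => expmx ((1 - t)%:C *: A) i j
                     * (t ^+ q.-1 / (q.-1)`!%:R)%:C).

End MatrixFunctions.

Section Quadrature.
Variable R : realType.

(* The interpolatory weight on [-1, 1] is the integral of the Lagrange basis
   polynomial attached to the node. *)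
Definition interp_weight m (x : 'I_m -> R) (i : 'I_m) : R :=
  \int[lebesgue_measure]_(s in `[-1, 1])
     \prod_(j < m | j != i) ((s - x j) / (x i - x j)).

Definition node01 m (x : 'I_m -> R) (i : 'I_m) : R := (x i + 1) / 2.

Definition weight01 m (x : 'I_m -> R) (i : 'I_m) : R := interp_weight x i / 2.

Definition clenshaw_curtis_node (n : nat) (k : 'I_n.+1) : R :=
  cos (k%:R * pi / n%:R).

(* Rodrigues' formula. *)
Definition legendre (m : nat) : {poly R} :=
  (2 ^+ m * m`!%:R)^-1 *: (('X^2 - 1) ^+ m)^`(m).

(* [x] lists the zeros of the Legendre polynomial of degree [m], each once. *)
Definition gauss_legendre_nodes m (x : 'I_m -> R) : Prop :=
  injective x /\ forall r : R, root (legendre m) r <-> exists i, x i = r.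

(* The interpolatory rule with nodes [x] on [-1, 1], moved to [0, 1] and applied
   to the integral defining [phi p.+1 A *m b]. *)
Definition phi_quad (p : nat) N (A : 'M[R[i]]_N) (b : 'cV[R[i]]_N)
    m (x : 'I_m -> R) : 'cV[R[i]]_N :=
  \sum_(i < m) (weight01 x i * (node01 x i ^+ p / p`!%:R))%:C
     *: (expmx ((1 - node01 x i)%:C *: A) *m b).

End Quadrature.

Section Bound.
Variable R : realType.

Definition g_rho (rho : R) : R := (rho + 1) ^+ 2 / (2 * rho).

Definition M_rho (p : nat) N (A : 'M[R[i]]_N) (b : 'cV[R[i]]_N) (rho : R) : R :=
  g_rho rho ^+ p / (2 ^+ p.+1 * p`!%:R)
  * expR (2^-1 * g_rho rho * mnorm_infty A) * vnorm_infty b.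

Definition quartic (a3 a2 a1 rho : R) : R :=
  rho ^+ 4 + a3 * rho ^+ 3 + a2 * rho ^+ 2 + a1 * rho + 1.

End Bound.

(* Main.v *)
Require Import Defs.
From HB Require Import structures.
From mathcomp Require Import all_boot all_order all_algebra.
From mathcomp Require Import complex mxtens.
From mathcomp Require Import all_classical all_reals all_analysis.
From mathcomp Require Import measurable_realfun ring lra zify.
Import Order.TTheory GRing.Theory Num.Theory.
Import numFieldNormedType.Exports.

Set Implicit Arguments.
Unset Strict Implicit.
Unset Printing Implicit Defensive.

Local Open Scope ring_scope.
Local Open Scope complex_scope.

(** Every [rho > 1] satisfies the error bounds, so it is enough that the
    quartic has a root above 1.  It has one by the intermediate value theorem:
    its value at 1 is [- 8 / mnorm_infty A] in all three cases, and it is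
    positive far to the right ([quartic_root_gt1]).

    For the error bound, let [E = J - Q] be the difference on polynomials
    between the integral over [-1, 1] and the rule.  Expanding the exponential
    turns the error into the series over [k] of the values of [E] at [(1 +
    X)^p (1 - X)^k], up to scalar factors, times [A^k b] ([cvgC_phi_mul],
    [cvgC_phi_quad], [phi_term_error]).  So it suffices to bound these values.

    The argument usually given estimates Chebyshev coefficients by the maximum
    of the integrand on a Bernstein ellipse.  For the polynomials at hand a
    direct induction does the same: if [|E T_k| <= C * T_k(a)] for all [k],
    with [T_k] the Chebyshev polynomials, then [|E ((1 + X)^p (1 - X)^k)| <= C
    * (1 + a)^(p + k)], because [X T_k] is the mean of two neighbouring
    Chebyshev polynomials ([cheb_bound]).  With [a = (rho + 1/rho) / 2], the
    factor [1 + a] is [g_rho rho] and [T_k(a)] is at least [rho^k / 2].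

    For both rules [E T_k] vanishes for odd [k], by symmetry, and for [k < K],
    where [K] is [n + 1] for Clenshaw-Curtis ([n + 2] when [n] is even, as [n
    + 1] is then odd) and [2 n + 2] for Gauss.  For even [k >= K], which is at
    least 6, the integral of [T_k] is at most [2 / 35] in absolute value and
    the rule gives at most 2, so that [|E T_k| <= 72 / 35] and [C = 144 / 35 *
    rho^-K] will do.  The value of the rule is bounded for Clenshaw-Curtis by
    aliasing: on the nodes [T_k] coincides with some [T_k'] of degree at most
    [n], on which the rule is exact ([quad_cc_cheb]).  For Gauss it follows
    from exactness up to degree [2 n + 1], which makes the weights nonnegative
    ([quad_gauss_cheb_le]). *)

(** * Integrals of polynomials *)
Section PolyIntegral.
Variable R : realType.
Implicit Types (f g F : {poly R}) (a b : R).

(** The primitive vanishing at 0.  The coefficient of index 0 comes out as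
    [f`_0 / 0], which is 0 by the convention on inverses, so that the general
    formula covers it. *)
Definition pprim f : {poly R} := \poly_(i < (size f).+1) (f`_i.-1 / i%:R).

Lemma coef_pprim f i : (pprim f)`_i = f`_i.-1 / i%:R.
Proof.
rewrite coef_poly; case: ltnP => // fi; rewrite nth_default ?mul0r//.
by rewrite -ltnS (ltn_predK fi).
Qed.

Lemma deriv_pprim f : (pprim f)^`() = f.
Proof.
apply/polyP => i; rewrite coef_deriv coef_pprim /= -[LHS]mulr_natr divfK//.
Qed.

Lemma pprim_is_linear : linear pprim.
Proof.
move=> c f g; apply/polyP => i.
by rewrite coefD coefZ !coef_pprim coefD coefZ mulrDl mulrA.
Qed.

HB.instance Definition _ :=
  GRing.isLinear.Build R {poly R} {poly R} _ pprim pprim_is_linear.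

Definition pint a b f := (pprim f).[b] - (pprim f).[a].

Lemma pint_is_scalar a b : scalar (pint a b).
Proof. by move=> c f g; rewrite /pint linearP !hornerD !hornerZ /=; ring. Qed.

HB.instance Definition _ a b :=
  GRing.isLinear.Build R {poly R} R _ (pint a b) (pint_is_scalar a b).

Lemma deriv_eq0_const F : F^`() = 0 -> F = (F`_0)%:P.
Proof.
move=> F'0; apply/polyP => -[|i]; rewrite coefC//=.
have := congr1 (fun g => g`_i) F'0; rewrite coef_deriv coef0 => /eqP.
by rewrite -[X in X == _]mulr_natr mulf_eq0 pnatr_eq0 orbF => /eqP.
Qed.

Lemma pint_deriv a b F : pint a b F^`() = F.[b] - F.[a].
Proof.
have : (pprim F^`() - F)^`() = 0 by rewrite derivB deriv_pprim subrr.
move=> /deriv_eq0_const/eqP; rewrite subr_eq => /eqP.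
by rewrite /pint => ->; rewrite !hornerE; ring.
Qed.

Lemma Rintegral_horner a b f : a < b ->
  (\int[lebesgue_measure]_(t in `[a, b]) f.[t])%R = pint a b f.
Proof.
move=> ab; rewrite /Rintegral (@continuous_FTC2 _ _ (horner (pprim f)))//.
- by apply: continuous_subspaceT; exact: continuous_horner.
- split=> [t _||]; first exact: derivable_horner.
  + apply: cvg_at_right_filter; exact: continuous_horner.
  + apply: cvg_at_left_filter; exact: continuous_horner.
- by move=> t _; rewrite -derivE deriv_pprim.
Qed.

Lemma pint_ge0 a b f : a < b -> (forall t, a <= t <= b -> 0 <= f.[t]) ->
  0 <= pint a b f.
Proof.
move=> ab f0; rewrite -Rintegral_horner//; apply: Rintegral_ge0 => t /=.
by rewrite in_itv/=; exact: f0.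
Qed.

Lemma pint_comp_oppX a f : pint (- a) a (f \Po - 'X) = pint (- a) a f.
Proof.
rewrite -{1}(deriv_pprim f).
have -> : (pprim f)^`() \Po (- 'X) = (- (pprim f \Po - 'X))^`().
  by rewrite derivN deriv_comp derivN derivX mulrN1 opprK.
by rewrite pint_deriv !hornerE !horner_comp !hornerE !opprK /pint addrC.
Qed.

(** The substitution [t = (s + 1) / 2], by which a rule on [-1, 1] is moved to
    [0, 1]. *)
Lemma pint01 f : pint 0 1 f = 2^-1 * pint (-1) 1 (f \Po (2^-1 *: ('X + 1))).
Proof.
have -> : f \Po (2^-1 *: ('X + 1)) =
    (2 *: (pprim f \Po (2^-1 *: ('X + 1))))^`().
  rewrite derivZ deriv_comp deriv_pprim derivZ derivD derivX.
  rewrite -polyC1 derivC addr0.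
  rewrite polyC1 -scalerAr mulr1 scalerA.
  by rewrite (_ : 2 * 2^-1 = 1 :> R) ?scale1r//; field.
rewrite pint_deriv !hornerE !horner_comp !hornerE /pint.
have -> : (2^-1 * (1 + 1) : R) = 1 by lra.
have -> : (2^-1 * (- 1 + 1) : R) = 0 by lra.
by field.
Qed.

End PolyIntegral.

(** * Chebyshev polynomials *)
Section Chebyshev.
Variable R : realType.
Implicit Types (f g : {poly R}) (a t z : R) (k : nat).

Fixpoint cheb_rec k : {poly R} :=
  match k with
  | 0 => 1
  | k'.+1 => if k' is k''.+1 then 'X * cheb_rec k' *+ 2 - cheb_rec k''
               else 'X
  end.

Fixpoint chebU_rec k : {poly R} :=
  match k with
  | 0 => 1
  | k'.+1 =>
      if k' is k''.+1 then 'X * chebU_rec k' *+ 2 - chebU_rec k''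
      else 'X *+ 2
  end.

(** The polynomials of the first ([cheb]) and second ([chebU]) kind are locked
    so that rewriting rules for sums and products do not match them through
    their recursive definition. *)
Definition cheb := locked cheb_rec.
Definition chebU := locked chebU_rec.

Lemma cheb_ind2 (P : nat -> Prop) : P 0%N -> P 1%N ->
  (forall k, P k -> P k.+1 -> P k.+2) -> forall k, P k.
Proof.
move=> P0 P1 PS k; suff [] : P k /\ P k.+1 by [].
by elim: k => // k [Pk Pk1]; split=> //; exact: PS.
Qed.

Lemma cheb0 : cheb 0 = 1. Proof. by rewrite /cheb -lock. Qed.
Lemma cheb1 : cheb 1 = 'X. Proof. by rewrite /cheb -lock. Qed.
Lemma chebU0 : chebU 0 = 1. Proof. by rewrite /chebU -lock. Qed.
Lemma chebU1 : chebU 1 = 'X *+ 2. Proof. by rewrite /chebU -lock. Qed.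

Lemma chebSS k : cheb k.+2 = 'X * cheb k.+1 *+ 2 - cheb k.
Proof. by rewrite /cheb -lock. Qed.

Lemma chebSSz k : cheb k.+2 = 2 *: ('X * cheb k.+1) - cheb k.
Proof. by rewrite chebSS scaler_nat. Qed.

Lemma chebUSS k : chebU k.+2 = 'X * chebU k.+1 *+ 2 - chebU k.
Proof. by rewrite /chebU -lock. Qed.

Lemma mulX_cheb k : 'X * cheb k.+1 = 2^-1 *: (cheb k.+2 + cheb k).
Proof.
by rewrite chebSSz subrK scalerA mulVf ?scale1r ?pnatr_eq0.
Qed.

Lemma size_cheb k : (size (cheb k) <= k.+1)%N.
Proof.
elim/cheb_ind2: k => [||k IH0 IH1];
  rewrite ?cheb0 ?cheb1 ?size_poly1 ?size_polyX//.
rewrite chebSSz (leq_trans (size_polyD _ _))// geq_max size_polyN.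
apply/andP; split; last exact: leq_trans IH0 (leqW (leqnSn _)).
rewrite (leq_trans (size_scale_leq _ _))// (leq_trans (size_polyMleq _ _))//.
by rewrite size_polyX.
Qed.

Lemma cheb_cos k t : (cheb k).[cos t] = cos (k%:R * t).
Proof.
elim/cheb_ind2: k => [||k IH0 IH1]; first by rewrite cheb0 mul0r cos0 hornerC.
  by rewrite cheb1 hornerX mul1r.
rewrite chebSS !hornerE IH0 IH1.
have -> : k.+2%:R * t = k.+1%:R * t + t by rewrite [k.+2%:R]mulrSr; ring.
have -> : k%:R * t = k.+1%:R * t - t by rewrite [k.+1%:R]mulrSr; ring.
by rewrite cosB cosD; ring.
Qed.

(** On the image of [z] under the Joukowski map the recurrence has the
    characteristic roots [z] and [z^-1].  For real [z = rho] this is the value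
    of the polynomial at the rightmost point of the Bernstein ellipse of
    parameter [rho]. *)
Lemma cheb_joukowski k z : z != 0 ->
  (cheb k).[2^-1 * (z + z^-1)] = 2^-1 * (z ^+ k + z ^- k).
Proof.
move=> z0; elim/cheb_ind2: k => [||k IH0 IH1].
- by rewrite cheb0 hornerC expr0 invr1; field.
- by rewrite cheb1 hornerX expr1.
rewrite chebSS !hornerE IH0 IH1 -!exprVn !exprS.
have : z * z^-1 = 1 by rewrite mulfV.
move: (z^-1) => y zy.
set u := _ + y * y ^+ k.
have -> : 2^-1 * (z + y) * (2^-1 * u) + 2^-1 * (z + y) * (2^-1 * u) =
   2^-1 * (z * (z * z ^+ k) + y * (y * y ^+ k)) +
    2^-1 * ((z * y) * z ^+ k + (z * y) * y ^+ k) by rewrite /u; field.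
by rewrite zy; ring.
Qed.

Lemma cheb_horner1 k : (cheb k).[1] = 1.
Proof.
elim/cheb_ind2: k => [||k IH0 IH1]; rewrite ?cheb0 ?cheb1 ?hornerC ?hornerX//.
by rewrite chebSS !hornerE IH0 IH1; ring.
Qed.

Lemma cheb_oppX k : cheb k \Po - 'X = (-1) ^+ k *: cheb k.
Proof.
elim/cheb_ind2: k => [||k IH0 IH1].
- by rewrite cheb0 -polyC1 comp_polyC expr0 scale1r.
- by rewrite cheb1 comp_polyX scaleN1r.
rewrite chebSSz rmorphB /= linearZ rmorphM /= IH0 IH1 comp_polyX.
rewrite scalerBr !exprS !mulN1r opprK scaleNr mulrN mulNr opprK.
by rewrite -scalerAr [in LHS]scalerA [2 * _]mulrC -scalerA.
Qed.

Lemma cheb_hornerN1 k : (cheb k).[-1] = (-1) ^+ k.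
Proof.
have := congr1 (horner^~ 1) (cheb_oppX k).
by rewrite /= horner_comp !hornerE cheb_horner1 mulr1.
Qed.

Lemma cheb_chebU k : cheb k.+1 = chebU k.+1 - 'X * chebU k.
Proof.
elim/cheb_ind2: k => [||k IH0 IH1].
- by rewrite cheb1 chebU1 chebU0; ring.
- by rewrite chebSS chebUSS cheb0 cheb1 chebU1 chebU0; ring.
by rewrite chebSS IH0 IH1 !chebUSS; ring.
Qed.

Lemma chebB_chebU k : cheb k.+2 = 2^-1 *: (chebU k.+2 - chebU k).
Proof.
apply: (scalerI (_ : 2 != 0 :> R)); first by rewrite pnatr_eq0.
rewrite scalerA mulfV ?scale1r ?pnatr_eq0// cheb_chebU chebUSS scaler_nat.
by ring.
Qed.

Lemma deriv_cheb k : (cheb k.+1)^`() = k.+1%:R *: chebU k.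
Proof.
rewrite scaler_nat.
elim/cheb_ind2: k => [||k IH0 IH1]; first by rewrite cheb1 chebU0 derivX.
  rewrite chebSS cheb0 cheb1 chebU1 derivB -polyC1 derivC subr0 derivMn derivM.
  by rewrite derivX; ring.
rewrite [in LHS]chebSS derivB derivMn derivM derivX IH0 IH1 cheb_chebU chebUSS.
rewrite -(mulr_natr _ k.+3) -(mulr_natr _ k.+2) -(mulr_natr _ k.+1) -!natr1.
by ring.
Qed.

(** An odd function has zero integral over a symmetric interval. *)
Lemma pint_cheb_odd k : odd k -> pint (-1) 1 (cheb k) = 0.
Proof.
move=> ok; have := pint_comp_oppX 1 (cheb k).
by rewrite cheb_oppX -signr_odd ok expr1 scaleN1r linearN /=; lra.
Qed.

(** [deriv_cheb] and [chebB_chebU] give the primitive [(T_(k+1) / (k+1) -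
    T_(k-1) / (k-1)) / 2] of [T_k], whose endpoint values are known. *)
Lemma pint_cheb_even k : ~~ odd k ->
  pint (-1) 1 (cheb k) = - 2 / (k%:R ^+ 2 - 1).
Proof.
case: k => [|[|k]]//.
  move=> _; have -> : cheb 0 = ('X : {poly R})^`() by rewrite cheb0 derivX.
  by rewrite pint_deriv !hornerX; field.
rewrite /= negbK => ek.
have k1 : k.+1%:R != 0 :> R by rewrite pnatr_eq0.
have k3 : k.+3%:R != 0 :> R by rewrite pnatr_eq0.
have -> : cheb k.+2 =
    (2^-1 *: (k.+3%:R^-1 *: cheb k.+3 - k.+1%:R^-1 *: cheb k.+1))^`().
  rewrite derivZ derivB !derivZ !deriv_cheb !scalerA !mulVf//.
  by rewrite !scale1r chebB_chebU.
have e1 : (-1) ^+ k.+1 = -1 :> R by rewrite -signr_odd /= ek.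
have e3 : (-1) ^+ k.+3 = -1 :> R by rewrite -signr_odd /= negbK ek.
move: (cheb_horner1 k.+1) (cheb_horner1 k.+3).
move: (cheb_hornerN1 k.+1) (cheb_hornerN1 k.+3); rewrite e1 e3 pint_deriv.
move: (cheb k.+1) (cheb k.+3) => T1 T3 T1N T3N T1P T3P.
rewrite !hornerE T1N T3N T1P T3P.
have -> : k.+2%:R ^+ 2 - 1 = k.+1%:R * k.+3%:R :> R by rewrite -!natr1; ring.
move: k1 k3; rewrite -!natr1 => k1 k3.
by field; rewrite k1 k3.
Qed.

Lemma pint_cheb_le2 k : `|pint (-1) 1 (cheb k)| <= 2.
Proof.
have [/pint_cheb_odd ->|ek] := boolP (odd k); first by rewrite normr0.
rewrite pint_cheb_even//; case: k ek => [|[|k]]// _.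
  by rewrite expr0n sub0r invrN invr1 mulrN1 opprK ger0_norm.
have : 4 <= k.+2%:R ^+ 2 :> R by rewrite -natrX (ler_nat _ 4) (leq_sqr 2).
move: (_ ^+ 2) => y y4; have y1 : 0 < y - 1 by lra.
by rewrite normrM normfV normrN !gtr0_norm// ler_pdivrMr//; lra.
Qed.

Lemma pint_cheb_ge6 k : ~~ odd k -> (6 <= k)%N ->
  `|pint (-1) 1 (cheb k)| <= 2 / 35.
Proof.
move=> ek k6; rewrite pint_cheb_even//.
have : 36 <= k%:R ^+ 2 :> R by rewrite -natrX (ler_nat _ 36) (leq_sqr 6).
move: (_ ^+ 2) => y y4; have y1 : 0 < y - 1 by lra.
by rewrite normrM normfV normrN !gtr0_norm// ler_pdivrMr//; lra.
Qed.

(** Multiplication by ['X] replaces [T_k] by the mean of its two neighbours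
    ([mulX_cheb]), and the same identity evaluated at [a] controls the two
    neighbours by [a * T_k(a)].  Multiplying the argument of [E] by [1 + 'X]
    or [1 - 'X] therefore costs at most a factor [1 + a], and the shape of the
    bound is preserved. *)
Lemma cheb_mul_bound (E : {scalar {poly R}}) g B a s : s = 1 \/ s = -1 ->
  (forall k, `|E (g * cheb k)| <= B * (cheb k).[a]) ->
  forall k, `|E (g * (1 + s *: 'X) * cheb k)| <= B * (1 + a) * (cheb k).[a].
Proof.
move=> sE Eg k.
have s1 : `|s| = 1 by case: sE => ->; rewrite ?normrN normr1.
have split_le h : E (g * (1 + s *: 'X) * h) = E (g * h) + s * E (g * ('X * h)).
  rewrite -linearZ -linearD; congr (E _).
  by rewrite mulrDr mulr1 -scalerAr mulrDl -scalerAl -!mulrA.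
rewrite split_le (le_trans (ler_normD _ _))// normrM s1 mul1r.
case: k => [|k].
  have := Eg 0%N; have := Eg 1%N.
  by rewrite cheb1 cheb0 !mulr1 hornerC hornerX !mulr1; nra.
have := Eg k; have := Eg k.+1; have := Eg k.+2.
rewrite mulX_cheb -scalerAr linearZ /= mulrDr linearD /= normrM.
rewrite (ger0_norm (_ : 0 <= 2^-1))// => h2 h1 h0.
have := ler_normD (E (g * cheb k.+2)) (E (g * cheb k)).
have aT : a * (cheb k.+1).[a] = 2^-1 * ((cheb k.+2).[a] + (cheb k).[a]).
  by have := congr1 (horner^~ a) (mulX_cheb k); rewrite /= !hornerE.
have -> : B * (1 + a) * (cheb k.+1).[a] =
  B * (cheb k.+1).[a] + B * (a * (cheb k.+1).[a]) by ring.
rewrite aT; set u := (cheb k.+2).[a] in h2 *; set v := (cheb k).[a] in h0 *.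
have -> : B * (2^-1 * (u + v)) = 2^-1 * (B * u + B * v) by ring.
lra.
Qed.

(** This takes the place of the estimate of Chebyshev coefficients by a
    contour integral over a Bernstein ellipse: on such an ellipse, [1 + a] is
    the maximum of [1 + z] and of [1 - z] in modulus, [a] being the semi-major
    axis. *)
Lemma cheb_bound (E : {scalar {poly R}}) C a p m :
  (forall k, `|E (cheb k)| <= C * (cheb k).[a]) ->
  `|E ((1 + 'X) ^+ p * (1 - 'X) ^+ m)| <= C * (1 + a) ^+ (p + m).
Proof.
move=> EC; suff H : forall k, `|E ((1 + 'X) ^+ p * (1 - 'X) ^+ m * cheb k)| <=
    C * (1 + a) ^+ (p + m) * (cheb k).[a].
  by have := H 0%N; rewrite cheb0 mulr1 hornerC mulr1.
elim: m => [|m IH].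
  rewrite addn0; elim: p => [|p IH] k; first by rewrite !expr0 !mul1r mulr1.
  rewrite expr0 !mulr1 in IH *; rewrite !exprSr [C * _]mulrA -['X]scale1r.
  by apply: cheb_mul_bound => [|j]; [left|rewrite scale1r].
move=> k; rewrite addnS !exprSr !mulrA -[in X in _ * X * cheb k]scaleN1r.
by apply: cheb_mul_bound; [right|].
Qed.

End Chebyshev.

(** * Interpolatory rules *)
Section InterpolatoryRule.
Variables (R : realType) (m : nat) (x : 'I_m -> R).
Hypothesis x_inj : injective x.
Implicit Types f : {poly R}.

Definition lagrange (i : 'I_m) : {poly R} :=
  \prod_(j < m | j != i) ((x i - x j)^-1 *: ('X - (x j)%:P)).

Definition quad f : R := \sum_i interp_weight x i * f.[x i].

Definition qerr f : R := pint (-1) 1 f - quad f.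

Lemma quad_is_scalar : scalar quad.
Proof.
move=> c f g; rewrite /quad mulr_sumr -big_split /=; apply: eq_bigr => i _.
by rewrite hornerD hornerZ; ring.
Qed.

HB.instance Definition _ :=
  GRing.isLinear.Build R {poly R} R _ quad quad_is_scalar.

Lemma qerr_is_scalar : scalar qerr.
Proof.
by move=> c f g; rewrite /qerr [pint _ _ _]linearP [quad _]linearP /=; ring.
Qed.

HB.instance Definition _ :=
  GRing.isLinear.Build R {poly R} R _ qerr qerr_is_scalar.

Lemma interp_weightE i : interp_weight x i = pint (-1) 1 (lagrange i).
Proof.
rewrite -Rintegral_horner; last by lra.
rewrite /interp_weight; congr (Rintegral _ _ _); apply/funext => s.
by rewrite horner_prod; apply: eq_bigr => j _; rewrite !hornerE mulrC.
Qed.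

Lemma size_lagrange i : (size (lagrange i) <= m)%N.
Proof.
rewrite /lagrange (leq_trans (size_poly_prod_leq _ _))//.
have -> : (\sum_(j < m | j != i) size ((x i - x j)^-1 *: ('X - (x j)%:P))
           = \sum_(j < m | j != i) 2)%N.
  apply: eq_bigr => j ji; rewrite size_scale ?size_XsubC//.
  by rewrite invr_eq0 subr_eq0; apply: contra ji => /eqP/x_inj->.
rewrite sum_nat_const cardC1 card_ord; have := ltn_ord i; lia.
Qed.

Lemma lagrange_node i j : (lagrange i).[x j] = (i == j)%:R.
Proof.
rewrite /lagrange horner_prod; have [<-|ij] := eqVneq i j.
  rewrite big1// => k ki; rewrite !hornerE mulVf// subr_eq0.
  by apply: contra ki => /eqP/x_inj->.
by rewrite (bigD1 j) 1?eq_sym//= !hornerE subrr mulr0 mul0r.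
Qed.

Lemma lagrange_expansion f : (size f <= m)%N ->
  f = \sum_i f.[x i] *: lagrange i.
Proof.
move=> fm; apply/eqP; rewrite -subr_eq0.
apply/eqP/(@roots_geq_poly_eq0 _ _ [seq x i | i <- enum 'I_m]).
- apply/allP => _ /mapP[j _ ->]; apply/rootP.
  rewrite !hornerE horner_sum (bigD1 j)//= big1 ?addr0 => [|i ij].
    by rewrite hornerZ lagrange_node eqxx mulr1 subrr.
  by rewrite hornerZ lagrange_node (negPf ij) mulr0.
- by rewrite map_inj_uniq ?enum_uniq.
- rewrite size_map size_enum_ord (leq_trans (size_polyD _ _))// geq_max fm.
  rewrite size_polyN (leq_trans (size_sum _ _ _))//; apply/bigmax_leqP => i _.
  exact: leq_trans (size_scale_leq _ _) (size_lagrange i).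
Qed.

Lemma quad_exact f : (size f <= m)%N -> quad f = pint (-1) 1 f.
Proof.
move=> /lagrange_expansion {2}->; rewrite linear_sum; apply: eq_bigr => i _.
by rewrite linearZ /= mulrC interp_weightE.
Qed.

Lemma eq_quad f g : (forall i, f.[x i] = g.[x i]) -> quad f = quad g.
Proof. by move=> fg; apply: eq_bigr => i _; rewrite fg. Qed.

End InterpolatoryRule.

(** * From errors on Chebyshev polynomials to the geometric bound *)
Section ErrorFromChebyshev.
Variable R : realType.

(** [g_rho rho] is [1 + a], where [a] is the semi-major axis of the Bernstein
    ellipse of parameter [rho]. *)
Lemma g_rhoE (rho : R) : rho != 0 -> g_rho rho = 1 + 2^-1 * (rho + rho^-1).
Proof. by move=> rho0; rewrite /g_rho; field. Qed.

(** [T_k] at the semi-major axis is at least [rho ^+ k / 2].  For [k >= K]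
    this absorbs the bound [72 / 35] into the constant [144 / 35 * rho ^- K],
    with which [cheb_bound] applies. *)
Lemma rule_error_bound (E : {scalar {poly R}}) K p m (rho : R) : 1 < rho ->
  (forall k, odd k || (k < K)%N -> E (cheb R k) = 0) ->
  (forall k, ~~ odd k -> (K <= k)%N -> `|E (cheb R k)| <= 72 / 35) ->
  `|E ((1 + 'X) ^+ p * (1 - 'X) ^+ m)|
    <= 144 / 35 * rho ^- K * g_rho rho ^+ (p + m).
Proof.
move=> rho1 E0 EK; have rho0 : 0 < rho by rewrite (lt_trans ltr01).
rewrite g_rhoE ?gt_eqF//; apply: cheb_bound => k.
have rK : 0 < rho ^- K by rewrite invr_gt0 exprn_gt0.
have rk : 0 < rho ^+ k by rewrite exprn_gt0.
rewrite cheb_joukowski ?gt_eqF//.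
have [/E0 ->|/norP[ok]] := boolP (odd k || (k < K)%N).
  by rewrite normr0 !mulr_ge0 ?addr_ge0 ?invr_ge0 ?ltW ?exprn_gt0.
rewrite -leqNgt => Kk; apply: le_trans (EK k ok Kk) _.
have : 1 <= rho ^- K * rho ^+ k.
  by rewrite mulrC ler_pdivlMr ?exprn_gt0// mul1r ler_weXn2l// ltW.
have : 0 <= rho ^- K * rho ^- k by rewrite mulr_ge0 ?invr_ge0 ?exprn_ge0 ?ltW.
set u := rho ^- K; set v := rho ^+ k; set w := v^-1 => uw uv.
have -> : 144 / 35 * u * (2^-1 * (v + w)) = 72 / 35 * (u * v + u * w) by field.
lra.
Qed.

End ErrorFromChebyshev.

(** * Clenshaw-Curtis rule *)
Section ClenshawCurtis.
Variables (R : realType) (n : nat).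
Hypothesis n_gt0 : (0 < n)%N.
Local Notation x := (@clenshaw_curtis_node R n).
Local Notation T := (cheb R).

Lemma clenshaw_curtis_inj : injective x.
Proof.
have n0 : (0 : R) < n%:R by rewrite ltr0n.
have node_itv (k : 'I_n.+1) : k%:R * pi / n%:R \in `[0, pi : R].
  rewrite in_itv /= divr_ge0 ?mulr_ge0 ?pi_ge0 ?ler0n//=.
  by rewrite ler_pdivrMr// mulrC ler_pM2l ?pi_gt0// ler_nat -ltnS.
move=> i j /(cos_inj (node_itv i) (node_itv j)).
move=> /(mulIf (invr_neq0 (lt0r_neq0 n0))) /(mulIf (lt0r_neq0 (pi_gt0 R))).
by move=> /eqP; rewrite eqr_nat => /eqP/val_inj.
Qed.

Lemma cosD2pin (y : R) k : cos (y + k%:R * (pi *+ 2)) = cos y.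
Proof.
elim: k => [|k IH]; first by rewrite mul0r addr0.
by rewrite -natr1 mulrDl mul1r addrA cosD2pi.
Qed.

Lemma cheb_node (k : nat) (j : 'I_n.+1) :
  (T k).[x j] = cos (k%:R * (j%:R * pi / n%:R)).
Proof. exact: cheb_cos. Qed.

(** Aliasing: at the nodes, [cos (k theta)] takes the same values for [k], for
    [2n - k] and for [k - 2n].  These shifts bring the index down to at most
    [n] and preserve its parity. *)
Lemma cheb_alias k : exists2 k', (k' <= n)%N /\ odd k' = odd k &
  forall j, (T k).[x j] = (T k').[x j].
Proof.
have nE : (n%:R : R) != 0 by rewrite pnatr_eq0 -lt0n.
elim/ltn_ind: k => k IH; have [kn|nk] := leqP k n; first by exists k.
have [k2n|k2n] := leqP k (n.*2).
  exists (n.*2 - k)%N => [|j]; first by split; lia.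
  rewrite !cheb_node natrB// -mul2n natrM.
  have -> : (2 * n%:R - k%:R) * (j%:R * pi / n%:R) =
    - (k%:R * (j%:R * pi / n%:R)) + j%:R * (pi *+ 2) :> R by field.
  by rewrite cosD2pin cosN.
have [|k' [k'n ok'] Tk'] := IH (k - n.*2)%N; first by lia.
exists k' => [|j]; first by split=> //; lia.
rewrite -Tk' !cheb_node -[in LHS](subnK (ltnW k2n)) natrD -mul2n natrM.
rewrite mul2n mulrDl.
have -> : 2 * n%:R * (j%:R * pi / n%:R) = j%:R * (pi *+ 2) :> R by field.
by rewrite cosD2pin.
Qed.

(** The rule sees [T_k] as a polynomial [T_k'] of degree at most [n], on which
    it is exact.  Bounds on the rule thus come from those on integrals,
    without any information on the signs of the weights. *)
Lemma quad_cc_cheb k : exists2 k', odd k' = odd k &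
  quad x (T k) = pint (-1) 1 (T k').
Proof.
have [k' [k'n ok'] Tk'] := cheb_alias k; exists k' => //.
rewrite (eq_quad Tk') quad_exact//; first exact: clenshaw_curtis_inj.
by rewrite (leq_trans (size_cheb _ _)).
Qed.

Lemma qerr_cc_cheb0 k : odd k || (k < n.+1)%N -> qerr x (T k) = 0.
Proof.
case/orP=> [ok|kn].
  have [k' ok' qk] := quad_cc_cheb k.
  by rewrite /qerr qk !pint_cheb_odd ?ok' ?subrr.
rewrite /qerr quad_exact ?subrr//; first exact: clenshaw_curtis_inj.
by rewrite (leq_trans (size_cheb _ _)).
Qed.

Lemma qerr_cc_cheb_le k : ~~ odd k -> (6 <= k)%N ->
  `|qerr x (T k)| <= 72 / 35.
Proof.
move=> ok k6; have [k' _ qk] := quad_cc_cheb k.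
rewrite /qerr qk (le_trans (ler_normB _ _))//.
have := pint_cheb_le2 R k'; have := pint_cheb_ge6 R ok k6; lra.
Qed.

End ClenshawCurtis.

(** * Legendre polynomials *)
Section LegendrePoly.
Variable R : realType.
Implicit Types (f q : {poly R}) (a : R).
Local Notation W m := (('X^2 - 1 : {poly R}) ^+ m).

(** Each derivation lowers the multiplicity of a root by at most one. *)
Lemma dvdp_exp_derivn a f k j :
  ('X - a%:P) ^+ (k + j) %| f -> ('X - a%:P) ^+ k %| f^`(j).
Proof.
elim: j k => [|j IH] k; first by rewrite addn0.
rewrite addnS -addSn => /IH /dvdpP[g gE]; rewrite derivnS gE derivM.
rewrite deriv_exp derivXsubC mul1r /=.
by rewrite dvdp_add ?dvdp_mull ?dvdp_exp2l// -mulr_natr dvdp_mulr.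
Qed.

Lemma derivn_rodrigues_root m j a : a ^+ 2 = 1 -> (j < m)%N ->
  (W m)^`(j).[a] = 0.
Proof.
move=> a2 jm; have dvdW : ('X - a%:P) %| ('X^2 - 1 : {poly R}).
  by rewrite -root_factor_theorem rootE !hornerE a2 subrr.
have : ('X - a%:P) ^+ (m - j + j) %| W m by rewrite subnK ?dvdp_exp2r// ltnW.
move=> /dvdp_exp_derivn; apply: contraTeq => aD.
have -> : (m - j)%N = (m - j).-1.+1 by lia.
apply: contra aD => dW; rewrite -rootE root_factor_theorem.
by rewrite (dvdp_trans _ dW)// exprS dvdp_mulr.
Qed.

Lemma pint_by_parts a b f q :
  pint a b (q * f^`()) =
  q.[b] * f.[b] - q.[a] * f.[a] - pint a b (q^`() * f).
Proof.
have -> : q * f^`() = (q * f)^`() - q^`() * f by rewrite derivM addrC addKr.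
by rewrite linearB /= pint_deriv !hornerM.
Qed.

(** Integration by parts moves the derivatives one by one to [q], which they
    eventually annihilate; the boundary terms vanish because 1 and -1 are
    roots of multiplicity [m] of [('X^2 - 1) ^+ m]. *)
Lemma rodrigues_ortho m j q : (j <= m)%N -> (size q <= j)%N ->
  pint (-1) 1 (q * (W m)^`(j)) = 0.
Proof.
elim: j q => [|j IH] q jm qj.
  by move: qj; rewrite leqn0 size_poly_eq0 => /eqP->; rewrite mul0r linear0.
rewrite derivnS pint_by_parts !derivn_rodrigues_root ?sqrrN ?expr1n//.
rewrite !mulr0 subrr sub0r IH ?oppr0//; first exact: ltnW.
have [->|q0] := eqVneq q 0; first by rewrite deriv0 size_poly0.
by rewrite -ltnS (leq_trans (lt_size_deriv q0)).
Qed.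

Lemma legendre_scale_neq0 m : (2 ^+ m * m`!%:R)^-1 != 0 :> R.
Proof.
by rewrite invr_eq0 mulf_neq0 ?expf_neq0 ?pnatr_eq0 -?lt0n ?fact_gt0.
Qed.

Lemma legendre_ortho m q : (size q <= m)%N ->
  pint (-1) 1 (q * legendre R m) = 0.
Proof.
by move=> qm; rewrite -scalerAr linearZ /= rodrigues_ortho// mulr0.
Qed.

Lemma size_legendre m : size (legendre R m) = m.+1.
Proof.
have mW : W m \is monic by rewrite monic_exp// monicXnsubC.
have sW : size (W m) = (m + m).+1.
  have := size_exp ('X^2 - 1 : {poly R}) m.
  have -> : size ('X^2 - 1 : {poly R}) = 3%N by rewrite -polyC1 size_XnsubC.
  have := monic_neq0 mW; rewrite -size_poly_gt0.
  by case: (size _) => //= s _ ->; rewrite mul2n addnn.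
rewrite size_scale ?legendre_scale_neq0//; apply/eqP; rewrite eqn_leq.
apply/andP; split.
  by apply/leq_sizeP => i mi; rewrite coef_derivn nth_default ?mul0rn// sW; lia.
rewrite ltnNge; apply/negP => /leq_sizeP/(_ m (leqnn m)).
(* The coefficient of index [m] of the derivative is the leading coefficient of
   [W m], which is 1, times a falling factorial. *)
rewrite coef_derivn; have := monicP mW; rewrite /lead_coef sW /= => -> /eqP.
by rewrite pnatr_eq0 -leqn0 leqNgt ffact_gt0 leq_addl.
Qed.

Lemma derivn_comp_oppX f k :
  (f \Po - 'X)^`(k) = (-1) ^+ k *: (f^`(k) \Po - 'X).
Proof.
elim: k => [|k IH]; first by rewrite expr0 scale1r.
rewrite derivnS IH derivZ deriv_comp derivN derivX mulrN1 -derivnS.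
by rewrite exprS mulN1r scaleNr scalerN.
Qed.

Lemma legendre_oppX m : legendre R m \Po - 'X = (-1) ^+ m *: legendre R m.
Proof.
have WN : W m \Po - 'X = W m.
  by rewrite rmorphXn rmorphB rmorphXn rmorph1 /= comp_polyX sqrrN.
rewrite /legendre linearZ /= -{2}WN derivn_comp_oppX !scalerA.
by rewrite mulrAC -expr2 sqrr_sign mul1r.
Qed.

End LegendrePoly.

(** * Gauss-Legendre rule *)
Section GaussLegendre.
Variables (R : realType) (m : nat) (x : 'I_m -> R).
Hypothesis x_nodes : gauss_legendre_nodes x.
Local Notation L := (legendre R m).
Local Notation T := (cheb R).
Implicit Types f : {poly R}.

Let x_inj : injective x. Proof. by case: x_nodes. Qed.

Let L_node i : L.[x i] = 0.
Proof. by apply/rootP; case: x_nodes => _ rL; apply/rL; exists i. Qed.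

Let L_neq0 : L != 0.
Proof. by rewrite -size_poly_gt0 size_legendre. Qed.

(** The nodes are roots of [L], so the rule depends on [f] only through its
    remainder modulo [L], whose degree is small enough for exactness. *)
Lemma quad_gauss_modp f : quad x f = pint (-1) 1 (f %% L).
Proof.
rewrite -(quad_exact x_inj); last first.
  by rewrite -ltnS -(size_legendre R m) ltn_modp.
apply: eq_quad => i.
by rewrite {1}(divp_eq f L) hornerD hornerM L_node mulr0 add0r.
Qed.

(** The quotient of [f] by [L] has degree less than [m], so orthogonality
    kills its contribution to the integral. *)
Lemma quad_gauss_exact f : (size f <= m.*2)%N -> quad x f = pint (-1) 1 f.
Proof.
move=> fm; rewrite quad_gauss_modp {2}(divp_eq f L) linearD /=.
by rewrite legendre_ortho ?add0r// size_divp// size_legendre leq_subLR addnn.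
Qed.

(** [L] is even or odd, so by uniqueness of the division the remainder of an
    odd polynomial is odd, and its integral vanishes.  This avoids matching
    each node with its opposite. *)
Lemma quad_gauss_odd f : f \Po - 'X = - f -> quad x f = 0.
Proof.
move=> fodd; rewrite quad_gauss_modp; set r := f %% L.
have rL : (size r < size L)%N by rewrite ltn_modp.
have rodd : r \Po - 'X = - r.
  apply/eqP; rewrite -eqr_oppLR; apply/eqP.
  apply: (@modpP _ f ((-1) ^+ m.+1 *: (f %/ L \Po - 'X))).
    rewrite -[LHS]opprK -fodd {1}(divp_eq f L) rmorphD rmorphM /= legendre_oppX.
    by rewrite opprD -scalerAr -scalerAl exprS mulN1r scaleNr.
  by rewrite size_polyN size_comp_poly2// size_polyN size_polyX.
by have := pint_comp_oppX 1 r; rewrite rodd linearN /=; lra.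
Qed.

(** [f * l ^+ 2], with [l] the Lagrange polynomial of node [i], has degree
    less than [2m], and the rule reduces on it to the term of node [i].  The
    cases [f = 1] and [f = 1 + s X] with [s = 1] or [s = -1] give the sign of
    the weight and the location of the node. *)
Lemma interp_weight_gauss_sqr f i :
  (forall s, -1 <= s <= 1 -> 0 <= f.[s]) -> (size f <= 2)%N ->
  0 <= interp_weight x i * f.[x i].
Proof.
move=> f0 f2; set l := lagrange x i.
have -> : interp_weight x i * f.[x i] = quad x (f * l ^+ 2).
  rewrite /quad (bigD1 i)//= big1 => [|j ji].
    by rewrite hornerM horner_exp lagrange_node// eqxx expr1n mulr1 addr0.
  by rewrite hornerM horner_exp lagrange_node// eq_sym (negPf ji) expr0n !mulr0.
rewrite quad_gauss_exact.
  apply: pint_ge0 => [|s s1]; first by lra.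
  by rewrite hornerM horner_exp mulr_ge0 ?sqr_ge0 ?f0.
have := size_lagrange x_inj i; have := size_polyMleq f (l ^+ 2).
have := size_poly_exp_leq l 2; rewrite -/l; have := ltn_ord i; lia.
Qed.

Lemma interp_weight_gauss_ge0 i : 0 <= interp_weight x i.
Proof.
have := @interp_weight_gauss_sqr 1 i; rewrite hornerC mulr1; apply.
  by move=> s _; rewrite hornerC.
by rewrite size_poly1.
Qed.

(** Nodes of zero weight do not contribute to the rule, and the others lie in
    [-1, 1], where Chebyshev polynomials are bounded by 1: this suffices for
    [quad_gauss_cheb_le]. *)
Lemma interp_weight_gauss_node i : interp_weight x i = 0 \/ -1 <= x i <= 1.
Proof.
have side s : `|s| = 1 -> 0 <= interp_weight x i * (1 + s * x i).
  move=> s1; have := @interp_weight_gauss_sqr (1%:P + s *: 'X) i.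
  rewrite !hornerE; apply.
    move=> t t1; rewrite !hornerE; have : `|s * t| <= 1.
      by rewrite normrM s1 mul1r ler_norml.
    by rewrite ler_norml => /andP[]; lra.
  rewrite (leq_trans (size_polyD _ _))// geq_max.
  rewrite (leq_trans (size_polyC_leq1 _))//.
  by rewrite (leq_trans (size_scale_leq _ _))// size_polyX.
have := interp_weight_gauss_ge0 i; rewrite le0r => /orP[/eqP|w0]; first by left.
right; have := side 1 (normr1 _); have := side (-1) (normrN1 _).
by rewrite !pmulr_rge0//; lra.
Qed.

Lemma quad_gauss_cheb_le k : `|quad x (T k)| <= 2.
Proof.
have : \sum_i interp_weight x i <= 2.
  have [m0|m0] := posnP m.
    by rewrite big1// => i; have := ltn_ord i; rewrite {2}m0.
  have <- : quad x 1 = \sum_i interp_weight x i.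
    by apply: eq_bigr => i _; rewrite hornerC mulr1.
  rewrite quad_gauss_exact ?size_poly1 ?double_gt0// -(cheb0 R).
  by rewrite (le_trans (ler_norm _))// pint_cheb_le2.
apply: le_trans; rewrite (le_trans (ler_norm_sum _ _ _))//.
apply: ler_sum => i _; rewrite normrM (ger0_norm (interp_weight_gauss_ge0 i)).
have [->|xi1] := interp_weight_gauss_node i; first by rewrite mul0r.
rewrite ler_piMr ?interp_weight_gauss_ge0//.
by rewrite -(acosK xi1) cheb_cos ler_norml cos_geN1 cos_le1.
Qed.

Lemma qerr_gauss_cheb0 k : odd k || (k < m.*2)%N -> qerr x (T k) = 0.
Proof.
case/orP=> [ok|km].
  rewrite /qerr pint_cheb_odd// quad_gauss_odd ?subrr//.
  by rewrite cheb_oppX -signr_odd ok expr1 scaleN1r.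
by rewrite /qerr quad_gauss_exact ?subrr// (leq_trans (size_cheb _ _)).
Qed.

Lemma qerr_gauss_cheb_le k : ~~ odd k -> (6 <= k)%N ->
  `|qerr x (T k)| <= 72 / 35.
Proof.
move=> ok k6; rewrite /qerr (le_trans (ler_normB _ _))//.
have := quad_gauss_cheb_le k; have := pint_cheb_ge6 R ok k6; lra.
Qed.

End GaussLegendre.

(** * Limits of complex sequences *)
Section ComplexLimits.
Import ComplexField.Normc.
Local Open Scope classical_set_scope.
Local Open Scope ring_scope.
Variable R : realType.
Implicit Types (u v : nat -> R[i]) (l z c : R[i]).

(** Convergence is taken on real and imaginary parts separately, to match
    [limC]. *)
Definition cvgC u l :=
  (fun k => complex.Re (u k)) @ \oo --> complex.Re l /\
  (fun k => complex.Im (u k)) @ \oo --> complex.Im l.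

Lemma cvgC_limC u l : cvgC u l -> limC u = l.
Proof.
by case: l => a b [ul vl]; rewrite /limC; congr Complex; exact: cvg_lim.
Qed.

Lemma cvgCD u v l z : cvgC u l -> cvgC v z ->
  cvgC (fun k => u k + v k) (l + z).
Proof.
have ReD (x y : R[i]) : complex.Re (x + y) = complex.Re x + complex.Re y.
  by case: x y => [? ?] [].
have ImD (x y : R[i]) : complex.Im (x + y) = complex.Im x + complex.Im y.
  by case: x y => [? ?] [].
move=> [u1 u2] [v1 v2]; split.
  by rewrite ReD; under eq_fun do rewrite ReD; exact: cvgD.
by rewrite ImD; under eq_fun do rewrite ImD; exact: cvgD.
Qed.

Lemma cvgCMr u l c : cvgC u l -> cvgC (fun k => u k * c) (l * c).
Proof.
have ReM (x y : R[i]) : complex.Re (x * y) =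
    complex.Re x * complex.Re y - complex.Im x * complex.Im y.
  by case: x y => [? ?] [].
have ImM (x y : R[i]) : complex.Im (x * y) =
    complex.Re x * complex.Im y + complex.Im x * complex.Re y.
  by case: x y => [? ?] [].
move=> [u1 u2]; split.
  rewrite ReM; under eq_fun do rewrite ReM.
  by apply: cvgB; apply: cvgMl.
rewrite ImM; under eq_fun do rewrite ImM.
by apply: cvgD; apply: cvgMl.
Qed.

Lemma cvgC_sum (I : Type) (r : seq I) (u : I -> nat -> R[i]) (l : I -> R[i]) :
  (forall i, cvgC (u i) (l i)) ->
  cvgC (fun k => \sum_(i <- r) u i k) (\sum_(i <- r) l i).
Proof.
move=> ul; elim: r => [|i r IH].
  rewrite big_nil; under eq_fun do rewrite big_nil.
  by split; exact: cvg_cst.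
by rewrite big_cons; under eq_fun do rewrite big_cons; exact: cvgCD.
Qed.

Lemma cvgC_normc_le u l B : cvgC u l -> (forall k, normc (u k) <= B) ->
  normc l <= B.
Proof.
move=> [u1 u2] uB; have B0 : 0 <= B.
  by apply: le_trans (uB 0%N); case: (u 0%N) => a b; exact: sqrtr_ge0.
have -> : normc l = Num.sqrt (complex.Re l ^+ 2 + complex.Im l ^+ 2).
  by case: l u1 u2.
rewrite -[B]ger0_norm// -sqrtr_sqr ler_wsqrtr//.
have sq : (fun k => complex.Re (u k) ^+ 2 + complex.Im (u k) ^+ 2) @ \oo -->
    complex.Re l ^+ 2 + complex.Im l ^+ 2.
  by rewrite !expr2; under eq_fun do rewrite !expr2; apply: cvgD; exact: cvgM.
rewrite -(cvg_lim _ sq)//; apply: limr_le.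
  by apply/cvg_ex; eexists; exact: sq.
apply: nearW => k; have := uB k; case: (u k) => a b /= abB.
rewrite -(@ler_sqrt _ _ (B ^+ 2)) ?exprn_ge0// sqrtr_sqr ger0_norm//.
Qed.

Lemma normc_ge0 z : 0 <= normc z.
Proof. by case: z => a b; exact: sqrtr_ge0. Qed.

Lemma normc_ge_abs z : `|complex.Re z| <= normc z /\ `|complex.Im z| <= normc z.
Proof.
case: z => a b /=; rewrite -!sqrtr_sqr.
by split; rewrite ler_wsqrtr// ?lerDl ?lerDr sqr_ge0.
Qed.

Lemma normc_real (y : R) : normc y%:C = `|y|.
Proof. by rewrite /normc /= expr0n /= addr0 sqrtr_sqr. Qed.

Lemma normc_sum (I : Type) (r : seq I) (F : I -> R[i]) :
  normc (\sum_(i <- r) F i) <= \sum_(i <- r) normc (F i).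
Proof.
elim/big_rec2: _ => [|i y z _ IH]; first by rewrite normc0.
by rewrite (le_trans (le_normcD _ _))// lerD2l.
Qed.

End ComplexLimits.

(** * Maximum norms of matrix powers *)
Section InfinityNorms.
Import ComplexField.Normc.
Local Open Scope classical_set_scope.
Local Open Scope ring_scope.
Variable R : realType.
Implicit Types N : nat.

Lemma normc_le_vnorm N (v : 'cV[R[i]]_N) i : normc (v i 0) <= vnorm_infty v.
Proof. exact: le_bigmax. Qed.

Lemma vnorm_infty_ge0 N (v : 'cV[R[i]]_N) : 0 <= vnorm_infty v.
Proof. exact: bigmax_ge_id. Qed.

Lemma mnorm_infty_ge0 N (A : 'M[R[i]]_N) : 0 <= mnorm_infty A.
Proof. exact: bigmax_ge_id. Qed.

Lemma mnorm_infty_gt0 N (A : 'M[R[i]]_N) : A != 0 -> 0 < mnorm_infty A.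
Proof.
move=> A0; rewrite lt_neqAle mnorm_infty_ge0 andbT eq_sym.
apply: contra A0 => /eqP nA0; apply/eqP/matrixP => i j; rewrite mxE.
apply: eq0_normc; apply/eqP; rewrite eq_le normc_ge0 andbT -nA0.
apply: le_trans (le_bigmax _ _ i).
by rewrite (bigD1 j)//= lerDl sumr_ge0// => k _; exact: normc_ge0.
Qed.

Lemma vnorm_mulmx N (A : 'M[R[i]]_N) (v : 'cV[R[i]]_N) :
  vnorm_infty (A *m v) <= mnorm_infty A * vnorm_infty v.
Proof.
apply/bigmax_leP; split=> [|i _].
  by rewrite mulr_ge0 ?mnorm_infty_ge0 ?vnorm_infty_ge0.
rewrite mxE (le_trans (normc_sum _ _))//.
apply: (@le_trans _ _ ((\sum_j normc (A i j)) * vnorm_infty v)).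
  rewrite mulr_suml; apply: ler_sum => j _.
  by rewrite normcM ler_wpM2l ?normc_ge0 ?normc_le_vnorm.
rewrite ler_wpM2r ?vnorm_infty_ge0//.
exact: (le_bigmax _ (fun i => \sum_j normc (A i j))).
Qed.

Lemma vnorm_powmx_mul N (A : 'M[R[i]]_N) (v : 'cV[R[i]]_N) k :
  vnorm_infty (A ^+ k *m v) <= mnorm_infty A ^+ k * vnorm_infty v.
Proof.
elim: k => [|k IH]; first by rewrite !expr0 mul1mx mul1r.
rewrite !exprS -mulmxA (le_trans (vnorm_mulmx _ _))// -mulrA.
by rewrite ler_wpM2l ?mnorm_infty_ge0.
Qed.

(** The entry is a coordinate of the power applied to a vector of the
    canonical basis, which has norm 1. *)
Lemma normc_powmx_entry N (A : 'M[R[i]]_N) i j k :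
  normc ((A ^+ k) i j) <= mnorm_infty A ^+ k.
Proof.
have -> : (A ^+ k) i j = (A ^+ k *m (\col_l (l == j)%:R)) i 0.
  rewrite mxE (bigD1 j)//= mxE eqxx mulr1 big1 ?addr0// => l lj.
  by rewrite mxE (negPf lj) mulr0.
apply: le_trans (normc_le_vnorm _ _) (le_trans (vnorm_powmx_mul _ _ _) _).
rewrite ler_piMr ?exprn_ge0 ?mnorm_infty_ge0//.
apply/bigmax_leP; split=> // l _; rewrite mxE.
by case: eqP => _; rewrite ?normc1 ?normc0.
Qed.

End InfinityNorms.

(** * Series of exponential type *)
Section ExponentialSeries.
Import ComplexField.Normc.
Local Open Scope classical_set_scope.
Local Open Scope ring_scope.
Variables (R : realType) (d : nat -> R) (r : R).
Hypotheses (r_ge0 : 0 <= r) (d_le : forall k, `|d k| <= r ^+ k).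
Implicit Types (s t y : R) (k m : nat).

(** Partial sums of [\sum_k d_k s^k / k!].  With [d_k] the real or imaginary
    part of an entry of the [k]th power of [A], these are the partial sums of
    the corresponding entry of the exponential of [s A]. *)
Definition epoly m : {poly R} := \sum_(k < m) (d k / k`!%:R) *: 'X^k.

Lemma exp_partial_sum_le y m : 0 <= y ->
  \sum_(k < m) y ^+ k / k`!%:R <= expR y.
Proof.
move=> y0; rewrite -(big_mkord predT (fun k => y ^+ k / k`!%:R)).
apply: (@nondecreasing_cvgn_le _ (series (exp_coeff y))).
  by apply: nondecreasing_series => k _ _; exact: exp_coeff_ge0.
exact: is_cvg_series_exp_coeff.
Qed.

Lemma horner_epoly m s :
  (epoly m).[s] = \sum_(k < m) s ^+ k / k`!%:R * d k.
Proof.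
rewrite horner_sum; apply: eq_bigr => k _.
by rewrite hornerZ hornerXn mulrC [d k / _]mulrC mulrA.
Qed.

Lemma epoly_term_le s k :
  `|s ^+ k / k`!%:R * d k| <= (`|s| * r) ^+ k / k`!%:R.
Proof.
rewrite !normrM normfV [`|k`!%:R|]ger0_norm// normrX exprMn mulrAC.
by rewrite ler_wpM2r ?invr_ge0// ler_wpM2l ?exprn_ge0.
Qed.

Lemma epoly_le m s : `|(epoly m).[s]| <= expR (`|s| * r).
Proof.
rewrite horner_epoly (le_trans (ler_norm_sum _ _ _))//.
apply: le_trans (exp_partial_sum_le m (mulr_ge0 (normr_ge0 s) r_ge0)).
by apply: ler_sum => k _; exact: epoly_term_le.
Qed.

Lemma is_cvg_epoly s : cvgn (fun m => (epoly m).[s]).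
Proof.
have -> : (fun m => (epoly m).[s]) = series (fun k => s ^+ k / k`!%:R * d k).
  by apply/funext => m; rewrite horner_epoly /series /= big_mkord.
apply: normed_cvg.
apply: (@series_le_cvg _ _ (exp_coeff (`|s| * r))) => [k|k|k|].
- exact: normr_ge0.
- by rewrite exp_coeff_ge0// mulr_ge0.
- exact: epoly_term_le.
- exact: is_cvg_series_exp_coeff.
Qed.

Definition efun s : R := limn (fun m => (epoly m).[s]).

Lemma cvg_efun s : (fun m => (epoly m).[s]) @ \oo --> efun s.
Proof. exact: is_cvg_epoly. Qed.

(** Term-by-term integration, by dominated convergence: on [0, 1] the partial
    sums are bounded by [expR r]. *)
Lemma cvg_pint_efun (q : {poly R}) :
  (fun m => pint 0 1 ((epoly m \Po (1 - 'X)) * q)) @ \oo -->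
  (\int[lebesgue_measure]_(t in `[0, 1]) (efun (1 - t) * q.[t]))%R.
Proof.
pose D := `[0%R, 1%R]%classic : set R.
pose P m := (epoly m \Po (1 - 'X)) * q.
have PE m t : (P m).[t] = (epoly m).[1 - t] * q.[t].
  by rewrite hornerM horner_comp !hornerE.
have P_cvg t : (fun m => (P m).[t]) @ \oo --> efun (1 - t) * q.[t].
  by under eq_fun do rewrite PE; apply: cvgMl; exact: cvg_efun.
have mP m : measurable_fun D (horner (P m)).
  apply: measurable_funS (continuous_measurable_fun _) => //.
  exact: continuous_horner.
have mf : measurable_fun D (fun t => efun (1 - t) * q.[t]).
  by apply: (measurable_fun_cvg mP) => t _; exact: P_cvg.
(* A bound for [q] on [0, 1]. *)
pose B := \sum_(i < size q) `|q`_i|.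
have qB t : D t -> `|q.[t]| <= B.
  rewrite /D /= in_itv /= => /andP[t0 t1]; rewrite horner_coef.
  rewrite (le_trans (ler_norm_sum _ _ _))//; apply: ler_sum => i _.
  by rewrite normrM normrX ler_piMr// exprn_ile1// ger0_norm.
have PB m t : D t -> `|(P m).[t]| <= expR r * B.
  move=> Dt; rewrite PE normrM ler_pM ?qB//.
  apply: le_trans (epoly_le _ _) _; rewrite ler_expR ler_piMl//.
  by move: Dt; rewrite /D /= in_itv /= ler_norml => /andP[]; lra.
have int_cst : lebesgue_measure.-integrable D (cst (expR r * B)%:E).
  apply: (@continuous_compact_integrable _ (cst (expR r * B)) D).
    exact: segment_compact.
  exact: continuous_subspaceT (fun=> cvg_cst _).
have [||||int_f _ cvgI] := @dominated_convergence _ _ R lebesgue_measure D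
  (measurable_itv _) (fun m t => ((P m).[t])%:E)
  (fun t => (efun (1 - t) * q.[t])%:E) (cst (expR r * B)%:E) _ _ _ int_cst.
- by move=> m; apply/measurable_EFinP; exact: mP.
- by apply/measurable_EFinP; exact: mf.
- by apply: aeW => t _; apply: cvg_EFin; [exact: nearW|exact: P_cvg].
- by apply: aeW => t m Dt; rewrite abse_EFin lee_fin PB.
have fin_f : (\int[lebesgue_measure]_(x in D) (efun (1 - x) * q.[x])%:E)%E
    \is a fin_num by apply: integrable_fin_num int_f; exact: measurable_itv.
rewrite -(fineK fin_f) in cvgI.
apply: cvg_trans (fine_cvg cvgI); apply: near_eq_cvg; apply: nearW => m /=.
by rewrite -/(P m) -Rintegral_horner.
Qed.

End ExponentialSeries.

(** * The quadrature error as a power series in the matrix *)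
Section ErrorSeries.
Import ComplexField.Normc.
Local Open Scope classical_set_scope.
Local Open Scope ring_scope.
Variables (R : realType) (N p : nat) (A : 'M[R[i]]_N) (b : 'cV[R[i]]_N).
Local Notation reA i j := (fun k => complex.Re ((A ^+ k) i j)).
Local Notation imA i j := (fun k => complex.Im ((A ^+ k) i j)).

Lemma Re_sum_real (F : nat -> R) (z : nat -> R[i]) m :
  complex.Re (\sum_(k < m) (F k)%:C * z k) =
  \sum_(k < m) F k * complex.Re (z k).
Proof.
elim: m => [|m IH]; first by rewrite !big_ord0.
rewrite !big_ord_recr /= -IH; case: (\sum_(k < m) _) => c e.
by case: (z m) => u v /=; rewrite mul0r ?subr0 ?addr0.
Qed.

Lemma Im_sum_real (F : nat -> R) (z : nat -> R[i]) m :
  complex.Im (\sum_(k < m) (F k)%:C * z k) =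
  \sum_(k < m) F k * complex.Im (z k).
Proof.
elim: m => [|m IH]; first by rewrite !big_ord0.
rewrite !big_ord_recr /= -IH; case: (\sum_(k < m) _) => c e.
by case: (z m) => u v /=; rewrite mul0r ?subr0 ?addr0.
Qed.

Lemma cvgC_real_sum (F : nat -> R) (z : nat -> R[i]) l :
  (fun m => \sum_(k < m) F k * complex.Re (z k)) @ \oo --> complex.Re l ->
  (fun m => \sum_(k < m) F k * complex.Im (z k)) @ \oo --> complex.Im l ->
  cvgC (fun m => \sum_(k < m) (F k)%:C * z k) l.
Proof.
move=> Fr Fi; split.
  apply: cvg_trans Fr; apply: near_eq_cvg; apply: nearW => m.
  by rewrite -Re_sum_real.
apply: cvg_trans Fi; apply: near_eq_cvg; apply: nearW => m.
by rewrite -Im_sum_real.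
Qed.

Lemma powmx_scale (s : R) k : (s%:C *: A) ^+ k = (s ^+ k)%:C *: A ^+ k.
Proof.
elim: k => [|k IH]; first by rewrite !expr0 scale1r.
rewrite !exprS IH rmorphM /= -[LHS]/((s%:C *: A) *m _).
by rewrite -scalemxAl -scalemxAr scalerA.
Qed.

Lemma norm_reA i j k : `|reA i j k| <= mnorm_infty A ^+ k.
Proof.
apply: le_trans (normc_powmx_entry A i j k).
by case: (normc_ge_abs ((A ^+ k) i j)).
Qed.

Lemma norm_imA i j k : `|imA i j k| <= mnorm_infty A ^+ k.
Proof.
apply: le_trans (normc_powmx_entry A i j k).
by case: (normc_ge_abs ((A ^+ k) i j)).
Qed.

Lemma cvgC_exp_series (s : R) i j :
  cvgC (fun m => \sum_(k < m) (s ^+ k / k`!%:R)%:C * (A ^+ k) i j)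
       (efun (reA i j) s +i* efun (imA i j) s).
Proof.
apply: (cvgC_real_sum (F := fun k => s ^+ k / k`!%:R)
  (z := fun k => (A ^+ k) i j)) => /=.
  under eq_fun do rewrite -(horner_epoly (reA i j)).
  exact: (cvg_efun (mnorm_infty_ge0 A) (norm_reA i j)).
under eq_fun do rewrite -(horner_epoly (imA i j)).
exact: (cvg_efun (mnorm_infty_ge0 A) (norm_imA i j)).
Qed.

Lemma expmx_entry (s : R) i j :
  expmx (s%:C *: A) i j = efun (reA i j) s +i* efun (imA i j) s.
Proof.
rewrite mxE -(cvgC_limC (cvgC_exp_series s i j)); congr limC.
apply/funext => m; rewrite summxE; apply: eq_bigr => k _.
rewrite mxE powmx_scale mxE mulrA; congr (_ * _).
by rewrite mulrC rmorphM fmorphV rmorph_nat.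
Qed.

(** The coefficient of [A ^+ k] in the power series of the integrand of [phi
    p.+1 A]. *)
Definition phi_term k : {poly R} :=
  (k`!%:R * p`!%:R)^-1 *: ((1 - 'X) ^+ k * 'X^p).

Lemma horner_phi_term k t :
  (phi_term k).[t] = (1 - t) ^+ k / k`!%:R * (t ^+ p / p`!%:R).
Proof.
rewrite hornerZ hornerM horner_exp hornerXn hornerD hornerN hornerX hornerC.
by rewrite invfM; ring.
Qed.

Lemma pint_epoly (d : nat -> R) m :
  pint 0 1 ((epoly d m \Po (1 - 'X)) * (p`!%:R^-1 *: 'X^p)) =
  \sum_(k < m) pint 0 1 (phi_term k) * d k.
Proof.
rewrite raddf_sum mulr_suml linear_sum; apply: eq_bigr => k _ /=.
rewrite comp_polyZ rmorphXn /= comp_polyX /phi_term.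
rewrite -scalerAl -scalerAr !linearZ /= invfM; ring.
Qed.

(** Integrating the exponential series term by term expresses [phi p.+1 A] as
    a power series in [A].  With [cvgC_phi_quad], this makes the quadrature
    error of the matrix-valued integrand a series of quadrature errors of
    scalar polynomials. *)
Lemma cvgC_phi i j :
  cvgC (fun m => \sum_(k < m) (pint 0 1 (phi_term k))%:C * (A ^+ k) i j)
       (phi p.+1 A i j).
Proof.
pose q : {poly R} := p`!%:R^-1 *: 'X^p.
have qE t : t ^+ p / p`!%:R = q.[t] by rewrite !hornerE mulrC.
rewrite mxE /int01C /=.
have -> : (fun t => complex.Re (expmx ((1 - t)%:C *: A) i j *
      (t ^+ p / p`!%:R)%:C)) =
    (fun t => efun (reA i j) (1 - t) * q.[t]).
  by apply/funext => t; rewrite expmx_entry -qE /= mulr0 subr0.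
have -> : (fun t => complex.Im (expmx ((1 - t)%:C *: A) i j *
      (t ^+ p / p`!%:R)%:C)) =
    (fun t => efun (imA i j) (1 - t) * q.[t]).
  by apply/funext => t; rewrite expmx_entry -qE /= mulr0 add0r.
apply: (cvgC_real_sum (F := fun k => pint 0 1 (phi_term k))
  (z := fun k => (A ^+ k) i j)) => /=.
  under eq_fun do rewrite -(pint_epoly (reA i j)).
  exact: (cvg_pint_efun (mnorm_infty_ge0 A) (norm_reA i j)).
under eq_fun do rewrite -(pint_epoly (imA i j)).
exact: (cvg_pint_efun (mnorm_infty_ge0 A) (norm_imA i j)).
Qed.

Lemma sum_entry_mulmx (F : nat -> R) i m :
  \sum_j (\sum_(k < m) (F k)%:C * (A ^+ k) i j) * b j 0 =
  \sum_(k < m) (F k)%:C * (A ^+ k *m b) i 0.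
Proof.
under eq_bigr do rewrite mulr_suml.
rewrite exchange_big /=; apply: eq_bigr => k _.
by rewrite mxE mulr_sumr; apply: eq_bigr => j _; rewrite mulrA.
Qed.

Lemma cvgC_phi_mul i :
  cvgC (fun m => \sum_(k < m) (pint 0 1 (phi_term k))%:C * (A ^+ k *m b) i 0)
       ((phi p.+1 A *m b) i 0).
Proof.
rewrite mxE; under eq_fun do
  rewrite -(sum_entry_mulmx (fun k => pint 0 1 (phi_term k))).
by apply: cvgC_sum => j; apply: cvgCMr; exact: cvgC_phi.
Qed.

Variables (n : nat) (x : 'I_n -> R).

Lemma cvgC_phi_quad i :
  cvgC (fun m => \sum_(k < m)
          (\sum_l weight01 x l * (phi_term k).[node01 x l])%:C *
          (A ^+ k *m b) i 0)
       (phi_quad p A b x i 0).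
Proof.
pose c l : R := weight01 x l * (node01 x l ^+ p / p`!%:R).
have -> : phi_quad p A b x i 0 =
    \sum_l (\sum_j expmx ((1 - node01 x l)%:C *: A) i j * b j 0) * (c l)%:C.
  by rewrite summxE; apply: eq_bigr => l _; rewrite !mxE mulrC.
have -> : (fun m => \sum_(k < m) (\sum_l weight01 x l *
      (phi_term k).[node01 x l])%:C * (A ^+ k *m b) i 0) =
    (fun m => \sum_l (\sum_j (\sum_(k < m)
      ((1 - node01 x l) ^+ k / k`!%:R)%:C * (A ^+ k) i j) * b j 0) * (c l)%:C).
  apply/funext => m; under [RHS]eq_bigr do
    rewrite (sum_entry_mulmx (fun k => (1 - node01 x _) ^+ k / k`!%:R))
      mulr_suml.
  rewrite exchange_big /=; apply: eq_bigr => k _.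
  rewrite rmorph_sum mulr_suml; apply: eq_bigr => l _ /=.
  rewrite [RHS]mulrAC; congr (_ * _); rewrite /c horner_phi_term.
  by rewrite -[RHS]rmorphM /= mulrCA.
apply: cvgC_sum => l; apply: cvgCMr; apply: cvgC_sum => j; apply: cvgCMr.
rewrite expmx_entry; exact: cvgC_exp_series.
Qed.

(** Under [t = (s + 1) / 2], the factors [t] and [1 - t] become [(1 + s) / 2]
    and [(1 - s) / 2]. *)
Lemma phi_term_error k :
  pint 0 1 (phi_term k) - \sum_l weight01 x l * (phi_term k).[node01 x l] =
  (2 ^+ (p + k).+1 * (k`!%:R * p`!%:R))^-1 *
    qerr x ((1 + 'X) ^+ p * (1 - 'X) ^+ k).
Proof.
pose h : {poly R} := 2^-1 *: ('X + 1).
have -> : \sum_l weight01 x l * (phi_term k).[node01 x l] =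
    2^-1 * quad x (phi_term k \Po h).
  rewrite mulr_sumr; apply: eq_bigr => l _.
  have hx : h.[x l] = node01 x l.
    by rewrite hornerZ hornerD hornerX hornerC /node01 mulrC.
  by rewrite horner_comp hx /weight01; ring.
rewrite pint01 -mulrBr -/(qerr x _).
have -> : phi_term k \Po h = (2 ^+ (p + k) * (k`!%:R * p`!%:R))^-1 *:
    ((1 + 'X) ^+ p * (1 - 'X) ^+ k).
  rewrite /phi_term comp_polyZ rmorphM !rmorphXn rmorphB rmorph1 /= comp_polyX.
  have -> : 1 - h = 2^-1 *: (1 - 'X).
    apply: (scalerI (_ : 2 != 0 :> R)); first by rewrite pnatr_eq0.
    rewrite scalerBr !scalerA mulfV ?pnatr_eq0// !scale1r scaler_nat; ring.
  rewrite /h !exprZn -scalerAl -scalerAr !scalerA [_ + 1]addrC exprD !invfM.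
  by rewrite -!exprVn [_ ^+ p * _]mulrC; congr (_ *: _); ring.
by rewrite linearZ /= exprS !invfM; ring.
Qed.

(** Each partial sum is bounded by a partial sum of the exponential series at
    [g_rho rho * mnorm_infty A / 2], which gives the exponential in [M_rho]. *)
Lemma phi_quad_error_series rho C : 0 < rho -> 0 <= C ->
  (forall k, `|qerr x ((1 + 'X) ^+ p * (1 - 'X) ^+ k)| <=
     C * g_rho rho ^+ (p + k)) ->
  vnorm_infty (phi p.+1 A *m b - phi_quad p A b x) <= C * M_rho p A b rho.
Proof.
move=> rho0 C0 err_le; have g0 : 0 <= g_rho rho.
  by rewrite divr_ge0 ?sqr_ge0 ?mulr_ge0 ?ltW.
pose D k := pint 0 1 (phi_term k) -
  \sum_l weight01 x l * (phi_term k).[node01 x l].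
pose c : R := C * (g_rho rho ^+ p / (2 ^+ p.+1 * p`!%:R)) * vnorm_infty b.
have c0 : 0 <= c.
  apply: mulr_ge0 (vnorm_infty_ge0 b); apply: mulr_ge0 => //.
  by rewrite divr_ge0 ?mulr_ge0 ?exprn_ge0.
have ME : C * M_rho p A b rho = c * expR (2^-1 * g_rho rho * mnorm_infty A).
  by rewrite /M_rho /c; ring.
have M0 : 0 <= C * M_rho p A b rho by rewrite ME mulr_ge0 ?expR_ge0.
apply/bigmax_leP; split=> // i _; rewrite mxE [X in _ + X]mxE.
apply: (cvgC_normc_le
  (u := fun m => \sum_(k < m) (D k)%:C * (A ^+ k *m b) i 0)).
  have := cvgCD (cvgC_phi_mul i) (cvgCMr (-1) (cvgC_phi_quad i)).
  rewrite mulrN1; congr (cvgC _ _); apply/funext => m.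
  rewrite mulrN1 -sumrB; apply: eq_bigr => k _.
  by rewrite -mulrBl; congr (_ * _); rewrite /D [RHS]rmorphB.
move=> m; rewrite (le_trans (normc_sum _ _))// ME.
apply: le_trans (ler_wpM2l c0 (exp_partial_sum_le m _)); last first.
  by apply: mulr_ge0 (mnorm_infty_ge0 A); apply: mulr_ge0.
rewrite mulr_sumr; apply: ler_sum => k _; rewrite normcM normc_real.
have -> : c * ((2^-1 * g_rho rho * mnorm_infty A) ^+ k / k`!%:R) =
    ((2 ^+ (p + k).+1 * (k`!%:R * p`!%:R))^-1 * (C * g_rho rho ^+ (p + k))) *
    (mnorm_infty A ^+ k * vnorm_infty b).
  by rewrite /c !exprMn !exprS !exprD !invfM -!exprVn; ring.
apply: ler_pM; rewrite ?normc_ge0//; last first.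
  exact: le_trans (normc_le_vnorm _ _) (vnorm_powmx_mul _ _ _).
rewrite /D phi_term_error normrM ger0_norm; last first.
  by rewrite invr_ge0 !mulr_ge0 ?exprn_ge0.
by rewrite ler_wpM2l// invr_ge0 !mulr_ge0 ?exprn_ge0.
Qed.

(** The bound obtained is of order [rho ^- K]; the factor [rho ^+ 2 / (rho ^+
    2 - 1)] relaxing it to the stated form is greater than 1. *)
Lemma phi_quad_error K (e : int) rho : 1 < rho -> e = 2 - K%:Z ->
  (forall k, odd k || (k < K)%N -> qerr x (cheb R k) = 0) ->
  (forall k, ~~ odd k -> (K <= k)%N -> `|qerr x (cheb R k)| <= 72 / 35) ->
  vnorm_infty (phi p.+1 A *m b - phi_quad p A b x) <=
    144 / 35 * (M_rho p A b rho * rho ^ e) / (rho ^+ 2 - 1).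
Proof.
move=> rho1 -> E0 EK; have rho0 : 0 < rho by rewrite (lt_trans ltr01).
have rK0 : 0 <= rho ^- K by rewrite invr_ge0 exprn_ge0// ltW.
have C0 : 0 <= 144 / 35 * rho ^- K by rewrite mulr_ge0.
have M0 : 0 <= M_rho p A b rho.
  apply: mulr_ge0 (vnorm_infty_ge0 b); apply: mulr_ge0 (expR_ge0 _).
  by rewrite divr_ge0 ?mulr_ge0 ?exprn_ge0// divr_ge0 ?sqr_ge0 ?mulr_ge0 ?ltW.
apply: le_trans (phi_quad_error_series rho0 C0 (fun k =>
  rule_error_bound p k rho1 E0 EK)) _.
have sq1 : 0 < rho ^+ 2 - 1 by rewrite subr_gt0 exprn_egt1.
rewrite ler_pdivlMr// expfzDr ?gt_eqF// -exprnN.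
have -> : rho ^ 2 = rho ^+ 2 by [].
have : 0 <= 144 / 35 * rho ^- K * M_rho p A b rho by rewrite mulr_ge0.
by move: (M_rho _ _ _ _) (rho ^- K) (rho ^+ 2) => M u v; lra.
Qed.

End ErrorSeries.

(** * The quartic equation *)
Section QuarticRoot.
Variable R : realType.

(** The hypothesis says that the quartic is negative at 1. *)
Lemma quartic_root_gt1 (a3 a2 a1 : R) : a3 + a2 + a1 + 2 < 0 ->
  exists2 rho, 1 < rho & quartic a3 a2 a1 rho = 0.
Proof.
move=> q1; pose q : {poly R} :=
  'X^4 + a3 *: 'X^3 + a2 *: 'X^2 + a1 *: 'X + 1%:P.
have qE r : q.[r] = quartic a3 a2 a1 r.
  by rewrite !(hornerD, hornerZ, hornerXn, hornerX, hornerC).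
(* A Cauchy bound: the leading term dominates from [s] on. *)
pose s := 1 + `|a3| + `|a2| + `|a1|.
have s1 : 1 <= s by rewrite /s -!addrA lerDl !addr_ge0.
have h k (a : R) : (k <= 3)%N -> - (`|a| * s ^+ 3) <= a * s ^+ k.
  move=> k3; rewrite -[a * _]opprK lerN2 (le_trans (ler_norm _))//.
  rewrite normrN normrM [`|s ^+ k|]ger0_norm ?exprn_ge0 ?(le_trans ler01)//.
  by rewrite ler_wpM2l// ler_weXn2l.
have [||r /andP[r1 _] /rootP] := @poly_ivt R q 1 s; first exact: s1.
  rewrite !qE /quartic !expr1n !mulr1; apply/andP; split; first by lra.
  have := h 3%N a3 isT; have := h 2%N a2 isT; have := h 1%N a1 isT.
  have s3 : 0 <= s ^+ 3 by rewrite exprn_ge0// (le_trans ler01).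
  have -> : s ^+ 4 = s ^+ 3 + `|a3| * s ^+ 3 + `|a2| * s ^+ 3 + `|a1| * s ^+ 3.
    by rewrite exprS {1}/s; ring.
  by rewrite expr1; lra.
rewrite qE => qr; exists r => //; rewrite lt_neqAle r1 andbT.
apply/eqP => r1E; move: qr q1; rewrite -r1E /quartic !expr1n !mulr1 => <-.
by rewrite addrC; lra.
Qed.

End QuarticRoot.

(** * The error bounds *)
Theorem theorem3p2 (R : realType) (N : nat) (A : 'M[R[i]]_N)
    (b : 'cV[R[i]]_N) (p n : nat) (A_neq0 : A != 0) (A_kron : kronecker_sum A) :
  let I := phi p.+1 A *m b in
  let nA := mnorm_infty A in
  let a2 := - (2 + 8 * p%:R * nA^-1) in
  [/\ (4 <= n)%N ->
        exists rho : R,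
          [/\ 1 < rho,
              quartic (- 4 * nA^-1 * (n%:R + 1 - p%:R)) a2
                      (4 * nA^-1 * (n%:R - 1 + p%:R)) rho = 0
            & vnorm_infty (I - phi_quad p A b (@clenshaw_curtis_node R n))
              <= 144 / 35 * (M_rho p A b rho * rho ^ (1 - n%:Z))
                 / (rho ^+ 2 - 1)],
      (2 <= n)%N ->
        forall x : 'I_n.+1 -> R, gauss_legendre_nodes x ->
        exists rho : R,
          [/\ 1 < rho,
              quartic (- 4 * nA^-1 * (2 * (n%:R + 1) - p%:R)) a2
                      (4 * nA^-1 * (2 * n%:R + p%:R)) rho = 0
            & vnorm_infty (I - phi_quad p A b x)
              <= 144 / 35 * (M_rho p A b rho * rho ^ (- (2 * n%:Z)))
                 / (rho ^+ 2 - 1)]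
    & (4 <= n)%N -> ~~ odd n ->
        exists rho : R,
          [/\ 1 < rho,
              quartic (- 4 * nA^-1 * (n%:R + 2 - p%:R)) a2
                      (4 * nA^-1 * (n%:R + p%:R)) rho = 0
            & vnorm_infty (I - phi_quad p A b (@clenshaw_curtis_node R n))
              <= 144 / 35 * (M_rho p A b rho * rho ^ (- n%:Z))
                 / (rho ^+ 2 - 1)]].
Proof.
move=> I nA a2.
have nAV : 0 < nA^-1 by rewrite invr_gt0 mnorm_infty_gt0.
(* In all three cases the value of the quartic at 1 is [- 8 * nA^-1]. *)
have root3 a3 a1 : a3 + a2 + a1 + 2 = - 8 * nA^-1 ->
    exists2 rho, 1 < rho & quartic a3 a2 a1 rho = 0.
  by move=> q1; apply: quartic_root_gt1; lra.
split=> [n4|n2 x xL|n4 en].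
- have n0 : (0 < n)%N by lia.
  have [|rho rho1 q0] := root3 (- 4 * nA^-1 * (n%:R + 1 - p%:R))
    (4 * nA^-1 * (n%:R - 1 + p%:R)); first by rewrite /a2; ring.
  exists rho; split=> //; apply: (@phi_quad_error _ _ _ _ _ _ _ n.+1) => //.
  + by lia.
  + by move=> k; exact: qerr_cc_cheb0.
  + by move=> k ok nk; apply: qerr_cc_cheb_le => //; lia.
- have [|rho rho1 q0] := root3 (- 4 * nA^-1 * (2 * (n%:R + 1) - p%:R))
    (4 * nA^-1 * (2 * n%:R + p%:R)); first by rewrite /a2; ring.
  exists rho; split=> //; apply: (@phi_quad_error _ _ _ _ _ _ _ n.+1.*2) => //.
  + by lia.
  + by move=> k; exact: qerr_gauss_cheb0.
  + by move=> k ok nk; apply: qerr_gauss_cheb_le => //; lia.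
- have n0 : (0 < n)%N by lia.
  have [|rho rho1 q0] := root3 (- 4 * nA^-1 * (n%:R + 2 - p%:R))
    (4 * nA^-1 * (n%:R + p%:R)); first by rewrite /a2; ring.
  (* For even [n] the rule is also exact on [T_(n+1)], which is odd. *)
  exists rho; split=> //; apply: (@phi_quad_error _ _ _ _ _ _ _ n.+2) => //.
  + by lia.
  + move=> k kn; apply: qerr_cc_cheb0 => //; lia.
  + by move=> k ok nk; apply: qerr_cc_cheb_le => //; lia.
Qed.
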